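(* Let $K(x;g)=\#\{n\leqslant x: k(n)\geqslant g\}$. Then uniformly for real $x\geqslant 2$ and $g\geqslant 2$, $$K(x;g)\ll\frac{x}{\log g},$$ with an absolute implied constant.
   Context: For $n\ge1$ let $t(n)$ be the rooted planar tree of $n$: $t(1)$ is the single-vertex tree; if $n=p_1^{a_1}\cdots p_s^{a_s}$ with primes $p_1<\dots<p_s$, $a_i\ge1$, then $t(n)$ is a root with $s$ ordered edges, the $i$-th leading to a copy of $t(a_i)$. Let $t^\#(n)$ be the corresponding nonplanar rooted tree (forgetting the order of children). For $n\ge1$, $k(n)=\max\{k\ge1: t^\#(n+1)=t^\#(n+2)=\cdots=t^\#(n+k)\}$. $f\ll g$ means $|f|\le Cg$ for a constant $C$. *)

(* Defs.v *)
From HB Require Import structures.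
From mathcomp Require Import all_boot all_order all_algebra.
From mathcomp Require Import all_classical all_reals all_analysis.

Set Implicit Arguments.
Unset Strict Implicit.
Unset Printing Implicit Defensive.

Import Order.TTheory GRing.Theory Num.Theory.

Inductive ptree : Type := PNode of seq ptree.

Definition children (t : ptree) : seq ptree := let: PNode ts := t in ts.

Fixpoint ptree_depth (t : ptree) : nat :=
  let: PNode ts := t in (foldr maxn 0 (map ptree_depth ts)).+1.

Fixpoint ptree_encode (t : ptree) : GenTree.tree nat :=
  let: PNode ts := t in GenTree.Node 0 (map ptree_encode ts).

Fixpoint ptree_decode (g : GenTree.tree nat) : ptree :=
  match g with
  | GenTree.Leaf _ => PNode [::]
  | GenTree.Node _ gs => PNode (map ptree_decode gs)
  end.

Lemma ptree_encodeK : cancel ptree_encode ptree_decode.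
Proof.
rewrite /cancel; fix IH 1; case=> ts /=; congr PNode.
by elim: ts => [|t ts IHts] //=; rewrite IH IHts.
Qed.

HB.instance Definition _ := Countable.copy ptree (can_type ptree_encodeK).

Lemma ptree_ind_in (P : ptree -> Prop) :
  (forall ts, (forall t, t \in ts -> P t) -> P (PNode ts)) -> forall t, P t.
Proof.
move=> HP; suff H n t : ptree_depth t <= n -> P t by move=> t; apply: (H _ t (leqnn _)).
elim: n t => [[ts]//|n IHn [ts] /=]; rewrite ltnS => le_ts.
apply: HP => t t_ts; apply: IHn; apply: leq_trans le_ts.
elim: ts t_ts => //= u ts IHts; rewrite inE => /predU1P[<-|/IHts le_t].
  exact: leq_maxl.
by rewrite (leq_trans le_t) ?leq_maxr.
Qed.

(* Isomorphism of rooted trees: the children of [u] can be reordered so that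
   they are pairwise isomorphic to the children of [t]. *)
Fixpoint ptree_iso (t u : ptree) {struct t} : bool :=
  let: PNode ts := t in
  has (fun us => all2 ptree_iso ts us) (permutations (children u)).

Lemma ptree_isoP (ts us : seq ptree) :
  reflect (exists2 vs, perm_eq vs us & all2 ptree_iso ts vs)
          (ptree_iso (PNode ts) (PNode us)).
Proof.
by apply: (iffP hasP) => -[vs Hvs ?]; exists vs; rewrite // ?mem_permutations //
  -mem_permutations.
Qed.

Lemma perm_all2 (T : eqType) (r : rel T) (us vs us' : seq T) :
  all2 r us vs -> perm_eq us' us ->
  exists2 vs', perm_eq vs' vs & all2 r us' vs'.
Proof.
case: us => [|x0 us0]; first by case: vs => // _ /perm_nilP ->; exists [::].
set us := x0 :: us0; rewrite all2E => /andP[/eqP sz_uv /allP r_uv].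
move=> /(perm_iotaP x0)[Is pIs ->]; exists (map (nth x0 vs) Is).
  by apply/(perm_iotaP x0); exists Is; rewrite -?sz_uv.
rewrite all2E !size_map eqxx zip_map; apply/allP => _ /mapP[i Ii ->] /=.
have lt_i : i < size us by move: Ii; rewrite (perm_mem pIs) mem_iota add0n.
have := r_uv (nth (x0, x0) (zip us vs) i).
by rewrite mem_nth ?size_zip -?sz_uv ?minnn // nth_zip //=; apply.
Qed.

Lemma ptree_iso_refl : reflexive ptree_iso.
Proof.
elim/ptree_ind_in => ts IHts; apply/ptree_isoP; exists ts => //.
elim: ts IHts => //= t ts IH H; rewrite H ?mem_head ?IH // => u u_ts.
by rewrite H // inE u_ts orbT.
Qed.

Lemma ptree_iso_imp_sym t u : ptree_iso t u -> ptree_iso u t.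
Proof.
elim/ptree_ind_in: t u => ts IHts [us] /ptree_isoP[vs vs_us ts_vs].
have vs_ts : all2 ptree_iso vs ts.
  elim: ts vs IHts {vs_us} ts_vs => [|t ts IH] [|v vs] //= H /andP[tv tsvs].
  rewrite (H t) ?mem_head //= IH // => w w_ts.
  by apply: H; rewrite inE w_ts orbT.
rewrite perm_sym in vs_us.
by have [ws ? ?] := perm_all2 vs_ts vs_us; apply/ptree_isoP; exists ws.
Qed.

Lemma ptree_iso_sym : symmetric ptree_iso.
Proof. by move=> t u; apply/idP/idP; apply: ptree_iso_imp_sym. Qed.

Lemma ptree_iso_trans : transitive ptree_iso.
Proof.
move=> u t; elim/ptree_ind_in: t u => ts IHts [us] [vs].
case/ptree_isoP=> us' us'_us ts_us' /ptree_isoP[vs' vs'_vs us_vs'].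
have [ws ws_vs' us'_ws] := perm_all2 us_vs' us'_us.
apply/ptree_isoP; exists ws; first exact: perm_trans ws_vs' vs'_vs.
elim: ts us' ws IHts ts_us' us'_ws {us'_us ws_vs'}
  => [|t ts IH] [|u us'] [|w ws] //= H /andP[tu tsus] /andP[uw usws].
rewrite (H t _ u) ?mem_head //= (IH us') // => x x_ts.
by apply: H; rewrite inE x_ts orbT.
Qed.

Canonical ptree_iso_equiv :=
  EquivRel ptree_iso ptree_iso_refl ptree_iso_sym ptree_iso_trans.

Definition nptree : Type := {eq_quot ptree_iso}%qT.
HB.instance Definition _ := Choice.on nptree.

Definition forget (t : ptree) : nptree := (\pi_({eq_quot ptree_iso}) t)%qT.

Lemma forget_eq t u : (forget t == forget u) = ptree_iso t u.
Proof. exact: eqmodE. Qed.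

(* The first argument is fuel; [n] itself always suffices, see [ntreeE]. *)
Fixpoint ntree_rec (fuel n : nat) : ptree :=
  if fuel is m.+1 then PNode [seq ntree_rec m pa.2 | pa <- prime_decomp n]
  else PNode [::].

Definition ntree (n : nat) : ptree := ntree_rec n n.

Lemma ntree_recE m n : n <= m -> ntree_rec m n = ntree n.
Proof.
rewrite /ntree; elim/ltn_ind: n m => n IHn [|m] le_nm; first by case: n le_nm {IHn}.
case: n IHn le_nm => [//|n] IHn; rewrite ltnS => le_nm /=; congr PNode.
apply/eq_in_map => -[p a] /= pa_n.
have [pr_p _ /dvdn_leq le_pa] := mem_prime_decomp pa_n.
have lt_an : a < n.+1 by apply: leq_trans (ltn_expl a (prime_gt1 pr_p)) (le_pa _).
by rewrite (IHn a lt_an m) ?(IHn a lt_an n) // (leq_trans _ le_nm).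
Qed.

Lemma ntreeE n : ntree n = PNode [seq ntree pa.2 | pa <- prime_decomp n].
Proof.
rewrite -(ntree_recE (leqnSn n)) /=; congr PNode.
apply/eq_in_map => -[p a] /= pa_n; apply: ntree_recE.
have [pr_p _ /dvdn_leq le_pa] := mem_prime_decomp pa_n.
case: (posnP n) pa_n => [->//|n_gt0 _].
by rewrite ltnW // (leq_trans (ltn_expl a (prime_gt1 pr_p)) (le_pa _)).
Qed.

Definition nptree_of (n : nat) : nptree := forget (ntree n).

Definition equal_run (n k : nat) : bool :=
  (1 <= k) && constant [seq nptree_of m | m <- iota n.+1 k].

Lemma equal_run_ex n : exists k, equal_run n k.
Proof. by exists 1. Qed.

Lemma nptree_of_children m n :
  nptree_of m = nptree_of n -> size (primes m) = size (primes n).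
Proof.
move/eqP; rewrite forget_eq !ntreeE => /ptree_isoP[vs /perm_size sz_vs].
by rewrite all2E => /andP[/eqP + _]; rewrite sz_vs !size_map.
Qed.

Lemma constant_eq (T : eqType) (s : seq T) x y :
  constant s -> x \in s -> y \in s -> x = y.
Proof.
case: s => //= z s /allP z_s.
by rewrite !inE => /predU1P[->|/z_s/eqP->] /predU1P[->|/z_s/eqP->].
Qed.

(* 2 ^ n.+1 and 6 ^ n.+1 both exceed [n] and have non-isomorphic trees. *)
Lemma equal_run_bound n k : equal_run n k -> k <= 6 ^ n.+1.
Proof.
case/andP=> _ cst; rewrite leqNgt; apply/negP => lt_k.
have in_run m : n < m -> m <= 6 ^ n.+1 ->
    nptree_of m \in [seq nptree_of m | m <- iota n.+1 k].
  move=> lt_nm le_m; apply: map_f; rewrite mem_iota lt_nm.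
  by rewrite (leq_ltn_trans le_m) // (leq_trans lt_k) // leq_addl.
have lt2 : n < 2 ^ n.+1 by apply: ltnW; apply: ltn_expl.
have le26 : 2 ^ n.+1 <= 6 ^ n.+1 by rewrite leq_exp2r.
have := constant_eq cst (in_run _ lt2 le26) (in_run _ (leq_trans lt2 le26) (leqnn _)).
by move/nptree_of_children; rewrite !primesX.
Qed.

Definition kmax (n : nat) : nat :=
  ex_maxn (equal_run_ex n) (@equal_run_bound n).

Definition Kcount (R : realType) (x g : R) : nat :=
  \sum_(1 <= n < (Num.truncn x).+1 | (g <= (kmax n)%:R)%R) 1.

(* Main.v *)
Require Import Defs.
From mathcomp Require Import all_boot all_order all_algebra.
From mathcomp Require Import all_classical all_reals all_analysis.
From mathcomp Require Import zify ring lra.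
Import Order.TTheory GRing.Theory Num.Theory.
Local Open Scope ring_scope.

(** Let [2 ^ L <= g < 2 ^ L.+1], and let [a] be the least of the numbers in
    [1, L-1] that have the most distinct prime factors.
    A run of length at least [2 ^ L] contains a number exactly divisible by
    [2 ^ a], so every [m] in the run has a child isomorphic to the tree of [a]:
    some [q ^ b] exactly divides [m], where [b] has as many prime factors as
    [a], whence [b >= a].  The numbers divisible by some [q ^ a] have density
    [O(2 ^ -a)].  Since [a * a.+1] has more prime factors than [a], it exceeds
    [L-1]; hence [a] is at least of order [sqrt L], and [2 ^ -a = O(1 / L)]. *)

(** Consecutive numbers are coprime, so any prime factor of [a.+1] is new to [a]. *)
Lemma size_primes_mulSn (a : nat) : (0 < a)%N ->
  (size (primes a) < size (primes (a * a.+1)))%N.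
Proof.
move=> a_gt0.
set q := pdiv a.+1.
have pr_q : prime q by apply: pdiv_prime; rewrite ltnS.
have q_a : q \notin primes a.
  rewrite mem_primes pr_q a_gt0 /=; apply/negP => q_dvd.
  have : (q %| 1)%N by rewrite -(dvdn_addr 1 q_dvd) addn1 pdiv_dvd.
  by rewrite dvdn1 => /eqP q1; rewrite q1 in pr_q.
have: uniq (q :: primes a) by rewrite /= q_a primes_uniq.
move/uniq_leq_size => /(_ (primes (a * a.+1))) /= H; apply: H => p.
rewrite inE primesM // => /predU1P[->|->//].
by rewrite [X in _ || X]mem_primes pr_q pdiv_dvd /= orbT.
Qed.

Lemma least_with_many_primes (A : nat) : (1 < A)%N ->
  exists a : nat, [/\ (1 < a)%N, (a <= A)%N, (A < a * a.+1)%N &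
    forall b, size (primes b) = size (primes a) -> (a <= b)%N].
Proof.
move=> A_gt1.
pose has_omega s := has (fun a => size (primes a) == s) (iota 1 A).
have omega_in a : (0 < a)%N -> (a <= A)%N -> has_omega (size (primes a)).
  move=> a0 aA; apply/hasP; exists a => //.
  by rewrite mem_iota a0 add1n ltnS.
have ex_s : exists s, has_omega s by exists (size (primes 2)); apply: omega_in.
(* The maximum exists because the distinct primes of [a] all lie in [[1, a]]. *)
have bound_s s : has_omega s -> (s <= A)%N.
  case/hasP => a; rewrite mem_iota add1n ltnS => /andP[a0 aA] /eqP <-.
  apply: leq_trans aA.
  have /uniq_leq_size : uniq (primes a) by exact: primes_uniq.
  move/(_ (iota 1 a)); rewrite size_iota; apply=> p.
  rewrite mem_primes mem_iota add1n ltnS => /and3P[/prime_gt0 -> _ pa] /=.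
  exact: dvdn_leq.
have [s s_in s_max] := ex_maxnP ex_s bound_s.
have s_gt0 : (0 < s)%N by apply: s_max (omega_in 2%N _ _).
(* The minimum is taken over all naturals, so its minimality is not limited to [b <= A]; [s_gt0]
   rules out 0 and 1. *)
have ex_a : exists a, size (primes a) == s.
  by have /hasP[a _ ?] := s_in; exists a.
have [a /eqP a_s a_min] := ex_minnP ex_a.
have a_gt1 : (1 < a)%N by case: a a_s {a_min} s_gt0 => [|[|//]] <-.
have a_le : (a <= A)%N.
  have /hasP[b] := s_in.
  rewrite mem_iota add1n ltnS => /andP[_ bA] /a_min ab.
  exact: leq_trans bA.
exists a; split=> // [|b b_s]; last by apply: a_min; rewrite b_s a_s.
rewrite ltnNge; apply/negP => le_A.
have a0 : (0 < a)%N by apply: ltnW.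
have := s_max _ (omega_in (a * a.+1)%N _ le_A).
by rewrite muln_gt0 a0 => /(_ isT); rewrite leqNgt -a_s size_primes_mulSn.
Qed.

Lemma nptree_of_child (m n p a : nat) :
  nptree_of m = nptree_of n -> (p, a) \in prime_decomp m ->
  exists q b, (q, b) \in prime_decomp n /\ nptree_of a = nptree_of b.
Proof.
move/eqP; rewrite forget_eq !ntreeE => /ptree_isoP[vs vs_n m_vs] pa_m.
have: has (ptree_iso (ntree a)) vs.
  elim: (prime_decomp m) vs m_vs pa_m {vs_n} => [|pb s IH] [|v vs] //=.
  rewrite inE => /andP[bv svs] /predU1P[pa|/(IH _ svs) ->]; last by rewrite orbT.
  by move: bv; rewrite -pa /= => ->.
case/hasP => v; rewrite (perm_mem vs_n) => /mapP[[q b] qb_n ->] iso_ab.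
by exists q, b; split=> //; apply/eqP; rewrite forget_eq.
Qed.

Lemma exact_pow2_in_window (n a : nat) : (0 < a)%N ->
  exists m, [/\ (n < m)%N, (m <= n + 2 ^ a.+1)%N & (2%N, a) \in prime_decomp m].
Proof.
(* The numbers exactly divisible by [T] are its odd multiples [2 * T * q + T]; this [q] gives the
   largest one that is at most [n + 2 * T]. *)
move=> a_gt0; set T := (2 ^ a)%N; pose q := ((n + T) %/ (2 * T))%N.
have T_gt0 : (0 < T)%N by rewrite expn_gt0.
have T2_gt0 : (0 < 2 * T)%N by rewrite muln_gt0.
have h1 : (q * (2 * T) <= n + T)%N := leq_divM _ _.
have h2 : (n + T < q.+1 * (2 * T))%N by rewrite ltn_ceil.
exists (T * (2 * q).+1)%N; rewrite expnS -/T; split; try nia.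
have m_gt0 : (0 < T * (2 * q).+1)%N by rewrite muln_gt0 T_gt0.
have log_m : logn 2 (T * (2 * q).+1) = a.
  rewrite lognM // pfactorK // logn_coprime ?addn0 // coprime2n /=.
  by rewrite oddM.
rewrite prime_decompE; apply/mapP; exists 2%N; last by rewrite log_m.
by rewrite -logn_gt0 log_m.
Qed.

Lemma long_run_pow_dvd (n a : nat) :
  (0 < a)%N -> (forall b, size (primes b) = size (primes a) -> (a <= b)%N) ->
  (2 ^ a.+1 <= kmax n)%N ->
  exists2 q, (1 < q)%N & (q ^ a %| n.+1)%N.
Proof.
move=> a_gt0 a_min; rewrite /kmax; case: ex_maxnP => k /andP[k_gt0 cst] _ le_k.
have [m [nm mn am]] := exact_pow2_in_window n _ a_gt0.
have in_run i : (n < i)%N -> (i <= n + k)%N ->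
    nptree_of i \in [seq nptree_of m | m <- iota n.+1 k].
  by move=> ni ik; apply: map_f; rewrite mem_iota ni addSn ltnS.
have eq_t : nptree_of m = nptree_of n.+1.
  apply: (constant_eq cst); apply: in_run; rewrite ?ltnS //.
    by rewrite (leq_trans mn) // leq_add2l.
  by rewrite -[n.+1]addn1 leq_add2l.
(* Isomorphic trees have equally many root children, so [b] has as many distinct primes as [a], and
   minimality gives [a <= b]. *)
have [q [b [/mem_prime_decomp[pr_q _ qb] /esym/nptree_of_children/a_min ab]]] :=
  nptree_of_child _ _ _ _ eq_t am.
exists q; first exact: prime_gt1.
exact: dvdn_trans (dvdn_exp2l q ab) qb.
Qed.

(** Union bound over [q]; the range is finite because [q <= q ^ a <= n.+1 <= N.+1]. *)
Lemma count_pow_multiples (P : pred nat) (a N : nat) : (0 < a)%N ->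
  (forall n, P n -> exists2 q, (1 < q)%N & (q ^ a %| n.+1)%N) ->
  (\sum_(1 <= n < N.+1 | P n) 1 <= \sum_(2 <= q < N.+2) N.+1 %/ q ^ a)%N.
Proof.
move=> a_gt0 HP.
apply: (@leq_trans
  (\sum_(1 <= n < N.+1) \sum_(2 <= q < N.+2) (q ^ a %| n.+1))%N).
  rewrite big_mkcond /= big_nat_cond [leqRHS]big_nat_cond.
  apply: leq_sum => n /andP[/andP[_ nN] _]; case: ifP => // /HP[q q1 qn].
  have q_n : (q <= n.+1)%N.
    apply: dvdn_leq => //; apply: dvdn_trans qn.
    by rewrite -{1}[q]expn1 dvdn_exp2l.
  rewrite (bigD1_seq q) /= ?iota_uniq ?qn //.
  by rewrite mem_index_iota q1 ltnS (leq_trans q_n).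
rewrite exchange_big /=; apply: leq_sum => q _.
(* The values [n.+1] run over [[2, N.+1]], while the quotient counts multiples from 1 on. *)
rewrite divn_count_dvd [leqRHS]big_add1 /= [leqRHS]big_ltn //.
exact: leq_addl.
Qed.

Lemma sum_inv_sqr_le (R : realFieldType) (M : nat) :
  \sum_(2 <= q < M.+2) (q%:R ^+ 2)^-1 <= 1 - M.+1%:R^-1 :> R.
Proof.
elim: M => [|M IH]; first by rewrite big_geq // invr1 subrr.
rewrite big_nat_recr //=; apply: le_trans (lerD IH (lexx _)) _.
have t_gt0 : (0 : R) < M.+1%:R by rewrite ltr0n.
rewrite -[M.+2]addn1 natrD; set t := M.+1%:R in t_gt0 *.
have t1_gt0 : 0 < t + 1 by lra.
rewrite -subr_ge0.
(* The slack in the telescoping bound of [1 / (t + 1) ^ 2] by [1 / t - 1 / (t + 1)]. *)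
have -> : 1 - (t + 1)^-1 - (1 - t^-1 + ((t + 1) ^+ 2)^-1) =
    (t * (t + 1) ^+ 2)^-1 by field; rewrite !gt_eqF.
by rewrite invr_ge0 mulr_ge0 ?exprn_ge0 ?ltW.
Qed.

(** For [q >= 2], [q ^ a >= 2 ^ (a - 2) * q ^ 2], and the inverse squares from 2 on sum to at most
    1. *)
Lemma sum_divn_pow_le (R : realFieldType) (a M N : nat) : (1 < a)%N ->
  (\sum_(2 <= q < M.+2) N %/ q ^ a)%:R <= N%:R * 4 / 2 ^+ a :> R.
Proof.
case: a => [|[|a]] // _; rewrite natr_sum.
apply: (@le_trans _ _
  (\sum_(2 <= q < M.+2) N%:R / 2 ^+ a * (q%:R ^+ 2)^-1)).
  rewrite big_nat_cond [leRHS]big_nat_cond.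
  apply: ler_sum => q /andP[/andP[q2 _] _].
  have q_gt0 : (0 : R) < q%:R by rewrite ltr0n (leq_trans _ q2).
  have qa_gt0 : (0 : R) < q%:R ^+ a.+2 by rewrite exprn_gt0.
  apply: (@le_trans _ _ (N%:R / q%:R ^+ a.+2)).
    by rewrite ler_pdivlMr // -natrX -natrM ler_nat leq_divM.
  rewrite -mulrA ler_wpM2l ?ler0n // -invfM.
  have b_gt0 : (0 : R) < 2 ^+ a * q%:R ^+ 2 by rewrite mulr_gt0 ?exprn_gt0.
  rewrite lef_pV2 ?posrE //.
  rewrite -[a.+2]addn2 exprD ler_wpM2r ?exprn_ge0 ?ler0n //.
  by apply: lerXn2r; rewrite ?nnegrE ?ler0n ?ler_nat.
rewrite -mulr_sumr.
have -> : N%:R * 4 / 2 ^+ a.+2 = N%:R / 2 ^+ a * 1 :> R.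
  by rewrite -[a.+2]addn2 exprD; field; rewrite expf_neq0 // pnatr_eq0.
rewrite ler_wpM2l ?divr_ge0 ?exprn_ge0 //.
apply: le_trans (sum_inv_sqr_le R M) _.
by rewrite lerBlDr lerDl invr_ge0 ler0n.
Qed.

Lemma quadratic_le_pow2 (a : nat) : (a * a.+1 + 1 <= 4 * 2 ^ a)%N.
Proof.
(* Doubling outgrows the quadratic only from 2 on, so the first cases are computed. *)
elim: a => // -[|[|a]] // IH; rewrite expnS.
by move: IH; set T := (2 ^ _)%N; nia.
Qed.

Lemma ln_le_of_le_pow2 (R : realType) (g : R) (n : nat) :
  0 < g -> g <= 2 ^+ n -> ln g <= n%:R.
Proof.
move=> g_gt0 g_le; apply: (@le_trans _ _ (ln (2 ^+ n))).
  by rewrite ler_ln ?posrE ?exprn_gt0.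
rewrite lnXn // -[ln 2 *+ n]mulr_natl ler_piMr //.
have -> : 2 = 1 + 1 :> R by lra.
by apply: le_ln1Dx; lra.
Qed.

Lemma Kcount_le (R : realType) (x g : R) : 0 <= x -> (Kcount x g)%:R <= x.
Proof.
move=> x_ge0; rewrite -truncn_ge_nat // /Kcount big_mkcond /=.
apply: (@leq_trans (\sum_(1 <= n < (Num.truncn x).+1) 1)%N).
  by apply: leq_sum => n _; case: ifP.
by rewrite sum_nat_const_nat muln1 subn1.
Qed.

Theorem theorem7 (R : realType) :
  exists C : R, forall x g : R, 2 <= x -> 2 <= g ->
    (Kcount x g)%:R <= C * (x / ln g).
Proof.
(* The final bound is [16 * (x + 1)], at most [24 * x] since [x >= 2]. *)
exists 24 => x g x_ge2 g_ge2.
have x_ge0 : 0 <= x by lra.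
have g_ge0 : 0 <= g by lra.
have ln_gt : 0 < ln g by apply: ln_gt0; lra.
have tg_ge2 : (2 <= Num.truncn g)%N by rewrite truncn_ge_nat.
pose L := trunc_log 2 (Num.truncn g).
have /andP[L_le L_gt] : (2 ^ L <= Num.truncn g < 2 ^ L.+1)%N.
  by apply: trunc_log_bounds => //; apply: ltnW.
have ln_le : ln g <= L.+1%:R.
  apply: ln_le_of_le_pow2; first lra.
  rewrite -natrX; apply: ltW; apply: lt_le_trans (truncnS_gt g) _.
  by rewrite ler_nat.
rewrite mulrA ler_pdivlMr //.
(* For small [L], [ln g <= 3] and the trivial count [x] suffice; otherwise [L.-1] is at least 2, as
   the choice of [a] requires. *)
have [L_le2|L_gt2] := leqP L 2.
  have : (L.+1%:R : R) <= 3%:R by rewrite ler_nat.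
  have := Kcount_le _ _ g x_ge0; have := ler0n R (Kcount x g); nra.
have A_gt1 : (1 < L.-1)%N by lia.
have [a [a_gt1 a_le A_lt a_min]] := least_with_many_primes _ A_gt1.
have a_gt0 : (0 < a)%N by apply: ltnW.
have HP n : g <= (kmax n)%:R -> exists2 q, (1 < q)%N & (q ^ a %| n.+1)%N.
  move=> g_k; apply: long_run_pow_dvd => //.
  apply: (@leq_trans (2 ^ L)); first by rewrite leq_exp2l //; lia.
  by apply: leq_trans L_le _; rewrite -(ler_nat R) (le_trans _ g_k) ?truncn_le.
have K_le : (Kcount x g)%:R <= (Num.truncn x).+1%:R * 4 / 2 ^+ a :> R.
  apply: le_trans (sum_divn_pow_le R _ (Num.truncn x) _ a_gt1).
  by rewrite ler_nat; apply: count_pow_multiples.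
have N_le : (Num.truncn x)%:R <= x by rewrite truncn_le.
(* From [L.-1 < a * a.+1] follows [L.+1 <= a * a.+1 + 1]. *)
have ln_le_a : ln g <= 4 * 2 ^+ a.
  apply: le_trans ln_le _; rewrite -natrX -natrM ler_nat.
  by apply: leq_trans (quadratic_le_pow2 a); lia.
have T_gt0 : (0 : R) < 2 ^+ a by rewrite exprn_gt0.
apply: le_trans (ler_wpM2r (ltW ln_gt) K_le) _.
apply: (@le_trans _ _ ((Num.truncn x).+1%:R * 4 / 2 ^+ a * (4 * 2 ^+ a))).
  by rewrite ler_wpM2l // divr_ge0 ?mulr_ge0 // ltW.
have -> : (Num.truncn x).+1%:R * 4 / 2 ^+ a * (4 * 2 ^+ a) =
    16 * (Num.truncn x).+1%:R :> R by field; rewrite gt_eqF.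
by rewrite -natr1; lra.
Qed.
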